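(* For each term $t$ over the signature $\Sigma^{pd}_m$ of partial meadows there are a division free term $s$ and a flat fracterm $r$ such that (i) $s\neq_{\mathsf p}0\to_\ell t=_{\mathsf p}r$ holds in all partial meadows (under all valuations), and (ii) $s=_{\mathsf p}0\wedge_\ell t=_{\mathsf p}t$ does not hold in any partial meadow under any valuation.
   Context: Signature and algebras. $\Sigma^{pd}_m$ is the one-sorted signature of unital rings (constants $0,1$; total functions $+,\cdot$ binary, $-$ unary) extended with a binary division symbol $\frac{x}{y}$ marked as partial. A partial meadow is a structure $F^{pd}$ obtained by expanding a field $F$ with the partial division $\frac ab=c$ iff $b\neq0$ and $b\cdot c=a$ (so $\frac a0$ is undefined). Terms may contain variables. A term is division free if the division symbol does not occur in it. A flat fracterm is a term of the form $\frac pq$ with $p$ and $q$ division free. Formulae. Atomic formulae are $t=_{\mathsf p}r$ for terms $t,r$; these are combined with $\neg$ and the short-circuit connectives $\vee_\ell$, $\wedge_\ell$, $\to_\ell$, where $\phi\wedge_\ell\psi$ means $\neg(\neg\phi\vee_\ell\neg\psi)$ and $\phi\to_\ell\psi$ means $\neg\phi\vee_\ell\psi$. $t\neq_{\mathsf p}r$ abbreviates $\neg(t=_{\mathsf p}r)$. Semantics. A valuation $\sigma$ assigns elements of the domain $|A|$ to variables; it extends to terms strictly ($\sigma(f(t_1,\dots,t_k))$ is defined iff all $\sigma(t_i)$ are defined and $f$ is defined on them). Satisfaction (''holds'') $A,\sigma\models\phi$ and denial satisfaction $A,\sigma\models^-\phi$ are defined by: - $A,\sigma\models t=_{\mathsf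 p}r$ iff $\sigma(t),\sigma(r)$ are both defined and equal; $A,\sigma\models^- t=_{\mathsf p}r$ iff both are defined and different; - $A,\sigma\models\neg\phi$ iff $A,\sigma\models^-\phi$; $A,\sigma\models^-\neg\phi$ iff $A,\sigma\models\phi$; - $A,\sigma\models\phi_1\vee_\ell\phi_2$ iff $A,\sigma\models\phi_1$, or both $A,\sigma\models^-\phi_1$ and $A,\sigma\models\phi_2$; $A,\sigma\models^-\phi_1\vee_\ell\phi_2$ iff $A,\sigma\models^-\phi_1$ and $A,\sigma\models^-\phi_2$. A formula holds in $A$ if $A,\sigma\models\phi$ for all valuations $\sigma$. *)

(* Defs.v *)
From mathcomp Require Import all_boot all_algebra.

Set Implicit Arguments.
Unset Strict Implicit.
Unset Printing Implicit Defensive.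

Import GRing.Theory.
Local Open Scope ring_scope.

Inductive term : Type :=
| Var of nat
| Zero
| One
| Add of term & term
| Opp of term
| Mul of term & term
| Div of term & term.

Fixpoint division_free (t : term) : bool :=
  match t with
  | Var _ | Zero | One => true
  | Opp t1 => division_free t1
  | Add t1 t2 | Mul t1 t2 => division_free t1 && division_free t2
  | Div _ _ => false
  end.

Definition flat_fracterm (t : term) : bool :=
  match t with
  | Div p q => division_free p && division_free q
  | _ => false
  end.

Inductive formula : Type :=
| FEq of term & term
| FNot of formula
| FOr of formula & formula.

Definition FAnd (phi psi : formula) : formula :=
  FNot (FOr (FNot phi) (FNot psi)).
Definition FImp (phi psi : formula) : formula := FOr (FNot phi) psi.
Definition FNeq (t r : term) : formula := FNot (FEq t r).

Declare Scope pmd_scope.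
Delimit Scope pmd_scope with pmd.
Notation "t =p r" := (FEq t r) (at level 70, no associativity) : pmd_scope.
Notation "t <>p r" := (FNeq t r) (at level 70, no associativity) : pmd_scope.
Notation "phi /\l psi" := (FAnd phi psi)
  (at level 80, right associativity) : pmd_scope.
Notation "phi \/l psi" := (FOr phi psi)
  (at level 85, right associativity) : pmd_scope.
Notation "phi ->l psi" := (FImp phi psi)
  (at level 99, psi at level 200, right associativity) : pmd_scope.

(** Structures for the signature; [None] stands for an undefined quotient. *)
Record partial_algebra : Type := PartialAlgebra {
  carrier :> Type;
  pa_zero : carrier;
  pa_one : carrier;
  pa_add : carrier -> carrier -> carrier;
  pa_opp : carrier -> carrier;
  pa_mul : carrier -> carrier -> carrier;
  pa_div : carrier -> carrier -> option carrier
}.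

Definition field_pdiv (F : fieldType) (a b : F) : option F :=
  if b == 0 then None else Some (a / b).

Lemma field_pdivP (F : fieldType) (a b c : F) :
  field_pdiv a b = Some c <-> b != 0 /\ b * c = a.
Proof.
rewrite /field_pdiv; case: eqVneq => [_|b0]; split => //.
- by case.
- by case=> <-; split=> //; rewrite mulrC divfK.
- by case=> _ <-; rewrite [b * c]mulrC mulfK.
Qed.

Definition partial_meadow (F : fieldType) : partial_algebra :=
  {| carrier := F; pa_zero := 0; pa_one := 1;
     pa_add := +%R; pa_opp := -%R; pa_mul := *%R;
     pa_div := @field_pdiv F |}.

Fixpoint eval (A : partial_algebra) (sigma : nat -> A) (t : term) : option A :=
  match t with
  | Var n => Some (sigma n)
  | Zero => Some (pa_zero A)
  | One => Some (pa_one A)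
  | Opp t1 => omap (@pa_opp A) (eval sigma t1)
  | Add t1 t2 =>
      obind (fun a => omap (pa_add a) (eval sigma t2)) (eval sigma t1)
  | Mul t1 t2 =>
      obind (fun a => omap (pa_mul a) (eval sigma t2)) (eval sigma t1)
  | Div t1 t2 =>
      obind (fun a => obind (pa_div a) (eval sigma t2)) (eval sigma t1)
  end.

Fixpoint sat (A : partial_algebra) (sigma : nat -> A) (phi : formula) : Prop :=
  match phi with
  | FEq t r =>
      match eval sigma t, eval sigma r with
      | Some a, Some b => a = b
      | _, _ => False
      end
  | FNot phi1 => den sigma phi1
  | FOr phi1 phi2 => sat sigma phi1 \/ (den sigma phi1 /\ sat sigma phi2)
  end
(** Denial satisfaction, not the negation of [sat]: an equation with an
    undefined side is neither satisfied nor denied. *)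
with den (A : partial_algebra) (sigma : nat -> A) (phi : formula) : Prop :=
  match phi with
  | FEq t r =>
      match eval sigma t, eval sigma r with
      | Some a, Some b => a <> b
      | _, _ => False
      end
  | FNot phi1 => sat sigma phi1
  | FOr phi1 phi2 => den sigma phi1 /\ den sigma phi2
  end.

Definition holds (A : partial_algebra) (phi : formula) : Prop :=
  forall sigma : nat -> A, sat sigma phi.

(* Main.v *)
(** Every term [t] has a flat fracterm [p / q] which, in all partial meadows, is
defined exactly when [t] is and then has the same value: in the induction, the
denominator of a compound keeps as factors the denominators of all its subterms
and, for a quotient, also the numerator of the divisor. Then [s := q] and
[r := p / q]. *)
Require Import Defs.
From mathcomp Require Import all_boot all_algebra.
From mathcomp Require Import ring.

Set Implicit Arguments.
Unset Strict Implicit.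
Unset Printing Implicit Defensive.

Import GRing.Theory.
Local Open Scope ring_scope.

(** Only division can be undefined. This reduces facts about flat fracterms to facts about
    [field_pdiv] on field elements. *)
Lemma eval_division_free (A : partial_algebra) (sigma : nat -> A) (t : term) :
  division_free t -> exists a, eval sigma t = Some a.
Proof.
elim: t => [n|||t IHt u IHu|t IHt|t IHt u IHu|//] /=; try by eexists.
- by case/andP=> /IHt[a ->] /IHu[b ->]; eexists.
- by case/IHt=> a ->; eexists.
- by case/andP=> /IHt[a ->] /IHu[b ->]; eexists.
Qed.

Section FieldPdiv.
Variable F : fieldType.
Implicit Types a b c d : F.

Lemma field_pdiv1 a : field_pdiv a 1 = Some a.
Proof. by rewrite /field_pdiv oner_eq0 divr1. Qed.

(** A field has no zero divisors, so [b * d] vanishes iff [b] or [d] does: both sides are undefined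
    together. *)
Lemma field_pdivD a b c d :
  obind (fun x => omap (+%R x) (field_pdiv c d)) (field_pdiv a b)
  = field_pdiv (a * d + c * b) (b * d).
Proof.
rewrite /field_pdiv mulf_eq0.
by case: (eqVneq b 0) (eqVneq d 0) => [_|b0] [_|d0] //=; rewrite addf_div.
Qed.

Lemma field_pdivN a b : omap -%R (field_pdiv a b) = field_pdiv (- a) b.
Proof. by rewrite /field_pdiv; case: eqP => //= _; rewrite mulNr. Qed.

Lemma field_pdivM a b c d :
  obind (fun x => omap ( *%R x) (field_pdiv c d)) (field_pdiv a b)
  = field_pdiv (a * c) (b * d).
Proof.
rewrite /field_pdiv mulf_eq0.
by case: (eqVneq b 0) (eqVneq d 0) => [_|b0] [_|d0] //=; rewrite mulf_div.
Qed.

(* The common factor [d] cannot be cancelled: it makes the right-hand side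
   undefined when [c / d] is. *)
Lemma field_pdiv_div a b c d :
  obind (fun x => obind (field_pdiv x) (field_pdiv c d)) (field_pdiv a b)
  = field_pdiv (a * d * d) (b * d * c).
Proof.
rewrite /field_pdiv !mulf_eq0.
case: (eqVneq b 0) (eqVneq d 0) => [_|b0] [_|d0] //=.
(* As [d] is nonzero, the divisor [c / d] is zero iff [c] is. *)
rewrite mulf_eq0 invr_eq0 (negPf d0) orbF; case: (eqVneq c 0) => //= c0.
by congr Some; field; rewrite b0 c0 d0.
Qed.

End FieldPdiv.

(** The pair [p], [q] depends on [t] alone, uniformly in the field and the valuation. Equality of
    options also covers definedness. *)
Lemma eval_flat_fracterm (t : term) :
  exists p q : term,
    [/\ division_free p, division_free q
      & forall (F : fieldType) (sigma : nat -> partial_meadow F),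
          eval sigma t = eval sigma (Div p q)].
Proof.
elim: t => [n|||t [p [q [dp dq E]]] u [p' [q' [dp' dq' E']]]
  |t [p [q [dp dq E]]]
  |t [p [q [dp dq E]]] u [p' [q' [dp' dq' E']]]
  |t [p [q [dp dq E]]] u [p' [q' [dp' dq' E']]]].
- by exists (Var n), One; split=> // F sigma /=; rewrite field_pdiv1.
- by exists Zero, One; split=> // F sigma /=; rewrite field_pdiv1.
- by exists One, One; split=> // F sigma /=; rewrite field_pdiv1.
- exists (Add (Mul p q') (Mul p' q)), (Mul q q').
  split=> [||F sigma] /=; rewrite ?dp ?dq ?dp' ?dq' // E E' /=.
  have [[a ->] [b ->]] := (eval_division_free sigma dp, eval_division_free sigma dq).
  have [[c ->] [d ->]] := (eval_division_free sigma dp', eval_division_free sigma dq').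
  exact: field_pdivD.
- exists (Opp p), q; split=> // F sigma /=; rewrite E /=.
  have [[a ->] [b ->]] := (eval_division_free sigma dp, eval_division_free sigma dq).
  exact: field_pdivN.
- exists (Mul p p'), (Mul q q').
  split=> [||F sigma] /=; rewrite ?dp ?dq ?dp' ?dq' // E E' /=.
  have [[a ->] [b ->]] := (eval_division_free sigma dp, eval_division_free sigma dq).
  have [[c ->] [d ->]] := (eval_division_free sigma dp', eval_division_free sigma dq').
  exact: field_pdivM.
(* This is [p * q'] over [q * p'], expanded by [q'] to retain the condition that [q'] is nonzero. *)
- exists (Mul (Mul p q') q'), (Mul (Mul q q') p').
  split=> [||F sigma] /=; rewrite ?dp ?dq ?dp' ?dq' // E E' /=.
  have [[a ->] [b ->]] := (eval_division_free sigma dp, eval_division_free sigma dq).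
  have [[c ->] [d ->]] := (eval_division_free sigma dp', eval_division_free sigma dq').
  exact: field_pdiv_div.
Qed.

Theorem theorem3p3p3 (t : term) :
  exists s r : term,
    division_free s /\ flat_fracterm r /\
    (forall F : fieldType,
        holds (partial_meadow F) (s <>p Zero ->l t =p r)%pmd) /\
    (forall (F : fieldType) (sigma : nat -> partial_meadow F),
        ~ sat sigma (s =p Zero /\l t =p t)%pmd).
Proof.
have [p [q [dp dq E]]] := eval_flat_fracterm t.
exists q, (Div p q); split=> //; split; first by rewrite /= dp.
split=> F sigma; rewrite /= E /=;
  have [[a ->] [b ->]] :=
    (eval_division_free sigma dp, eval_division_free sigma dq);
  rewrite /= /field_pdiv.
(* If [b] is zero the premise is denied, which suffices; otherwise both sides are [a / b]. *)
- by case: (eqVneq b 0) => [b0|/eqP b0]; [left | right].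
(* A zero denominator leaves [t] undefined, so [t =p t] fails. *)
- by case=> ->; rewrite eqxx.
Qed.
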